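(* Consider the inverse regression model $\mathbf X_i=\boldsymbol\mu+\boldsymbol\Gamma\boldsymbol\beta\mathbf f_i+\sigma\boldsymbol\epsilon_i$, $i=1,\dots,n$, described in the context, and suppose that the entries of the error vectors $\boldsymbol\epsilon_i$ are independent standard normal random variables. Then one can write $$\mathbb X^T\mathbb X=\widehat{\mathbb X}^T\widehat{\mathbb X}+\mathbf N,$$ where the random $p\times p$ matrix $\mathbf N$ is independent of $\widehat{\mathbb X}$ and of $\boldsymbol\Gamma$ (the latter, for the non-random parameter $\boldsymbol\Gamma$, meaning that $\mathbf N$ is a function of the $\mathbf f_i$, the $\boldsymbol\epsilon_i$ and $\sigma$ only, not involving $\boldsymbol\Gamma$).
   Context: Model. $n,p,d,r$ are positive integers with $d<p$ and $d\le r$. The parameters are $\boldsymbol\mu\in\mathbb R^p$, a $p\times d$ matrix $\boldsymbol\Gamma$ with $\boldsymbol\Gamma^T\boldsymbol\Gamma=\mathbf I_d$, a $d\times r$ matrix $\boldsymbol\beta$, and $\sigma>0$. The observations are $\mathbf X_i=\boldsymbol\mu+\boldsymbol\Gamma\boldsymbol\beta\mathbf f_i+\sigma\boldsymbol\epsilon_i\in\mathbb R^p$, $i=1,\dots,n$, where $\mathbf f_i\in\mathbb R^r$ are random vectors (functions of random responses) with $\sum_{i=1}^n\mathbf f_i=\mathbf 0$, and the errors $(\boldsymbol\epsilon_i)_{i\le n}$, with values in $\mathbb R^p$, are independent of $(\mathbf f_i)_{i\le n}$. Matrices. $\mathbb X$ is the $n\times p$ matrix with rows $(\mathbf X_i-\overline{\mathbf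 X})^T$, where $\overline{\mathbf X}=\frac1n\sum_i\mathbf X_i$; $\mathbf F$ is the $n\times r$ matrix with rows $\mathbf f_i^T$, assumed of full column rank $r$. $\mathbf P_{\mathbf F}=\mathbf F(\mathbf F^T\mathbf F)^{-1}\mathbf F^T$. The fitted matrix is $\widehat{\mathbb X}=\mathbf P_{\mathbf F}\mathbb X$. *)

(* Defs.v *)
From mathcomp Require Export all_boot all_order all_algebra.
From mathcomp Require Export all_classical all_reals all_analysis.

Set Implicit Arguments.
Unset Strict Implicit.
Unset Printing Implicit Defensive.

Export Order.TTheory GRing.Theory Num.Theory.
Export numFieldNormedType.Exports.

#[global] Open Scope classical_set_scope.
#[global] Open Scope ring_scope.

Section InverseRegression.
Context {R : realType}.

Definition rows_mx (n m : nat) (v : 'I_n -> 'cV[R]_m) : 'M[R]_(n, m) :=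
  \matrix_i (v i)^T.

Definition observation (p d r : nat) (mu : 'cV[R]_p) (Gamma : 'M[R]_(p, d))
    (beta : 'M[R]_(d, r)) (sigma : R) (f : 'cV[R]_r) (e : 'cV[R]_p) :
    'cV[R]_p :=
  mu + Gamma *m beta *m f + sigma *: e.

Definition sample_mean (n p : nat) (X : 'I_n -> 'cV[R]_p) : 'cV[R]_p :=
  n%:R^-1 *: \sum_i X i.

Definition centered_mx (n p : nat) (X : 'I_n -> 'cV[R]_p) : 'M[R]_(n, p) :=
  rows_mx (fun i => X i - sample_mean X).

(* The orthogonal projection onto the column space of F only when F has full
   column rank: [invmx A] is [A] when A is singular. *)
Definition col_proj (n r : nat) (F : 'M[R]_(n, r)) : 'M[R]_n :=
  F *m invmx (F^T *m F) *m F^T.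

Definition fitted_mx (n p r : nat) (f : 'I_n -> 'cV[R]_r)
    (X : 'I_n -> 'cV[R]_p) : 'M[R]_(n, p) :=
  col_proj (rows_mx f) *m centered_mx X.

Definition regular_scores (n r : nat) (f : 'I_n -> 'cV[R]_r) : Prop :=
  \sum_i f i = 0 /\ \rank (rows_mx f) = r.

End InverseRegression.

Section RandomMatrices.
Context {disp : measure_display} {T : measurableType disp} {R : realType}.

Definition random_mx (m n : nat) (M : T -> 'M[R]_(m, n)) : Prop :=
  forall i j, measurable_fun [set: T] (fun w => M w i j).

(* The sigma-algebra generated by the entries, which is the preimage under M of
   the Borel sigma-algebra of the space of m x n matrices. *)
Definition sigma_mx (m n : nat) (M : T -> 'M[R]_(m, n)) : set (set T) :=
  <<s \bigcup_(ij in [set: 'I_m * 'I_n])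
        preimage_set_system [set: T] (fun w => M w ij.1 ij.2) measurable >>.

Variable P : probability T R.

Definition indep_mx (m n m' n' : nat) (M : T -> 'M[R]_(m, n))
    (M' : T -> 'M[R]_(m', n')) : Prop :=
  forall A B, sigma_mx M A -> sigma_mx M' B ->
    P (A `&` B) = (P A * P B)%E.

Definition mutual_indep (I : finType) (X : I -> T -> R) : Prop :=
  forall (J : {set I}) (B : I -> set R),
    (forall i, i \in J -> measurable (B i)) ->
    P (\bigcap_(i in [set` J]) (X i @^-1` B i)) =
    (\prod_(i in J) P (X i @^-1` B i))%E.

(* The law is compared on measurable sets only: the value of a measure on any
   other set is unspecified. *)
Definition standard_normal (X : T -> R) : Prop :=
  measurable_fun [set: T] X /\
  forall B : set R, measurable B -> pushforward P X B = normal_prob 0 1 B.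

End RandomMatrices.

(* Main.v *)
(** With [H] the centering matrix and [P_F] the projection onto the scores, the
    decomposition holds with [N = sigma^2 E^T (H - P_F) E], because [H - P_F]
    annihilates the constant vector and the columns of [F].  For a fixed regular
    [F], a product [Q] of planar reflections that triangularizes [[1 | F]] turns
    [H - P_F] into the projection onto the last [n - r - 1] coordinates, while
    [P_F] only sees the first [r + 1] coordinates of [Q E].  The matrix [Q E] is
    again made of independent standard normal entries, so, given [F], [N] and the
    fitted matrix are independent and the law of [N] does not depend on [F].
    Integrating over [F] gives the unconditional independence. *)

Require Import Defs.
From HB Require Import structures.
From mathcomp Require Import measurable_realfun ring lra zify.

Set Implicit Arguments.
Unset Strict Implicit.
Unset Printing Implicit Defensive.

(** * Independence and generating boxes *)

(** Each planar reflection moves only two coordinates, so Gaussian invariance reduces to one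
    integral over the plane, and no change of variables in higher dimension occurs. The rotation [Q]
    depends on the scores and comes from a bare existence statement, so nothing says that it is
    measurable in [F]. It is therefore used only for frozen scores, inside the integrand of Fubini's
    formula, and is eliminated there by equality of laws. Conditional independence given [F] alone
    would not pass to the integral; what does is that the conditional law of [N] is a constant
    factor. The number r + 1 counts the columns of [1 | F]. *)

Section Independence.
Context {d : measure_display} {T : measurableType d} {R : realType}.
Variable P : probability T R.

(** With [B] fixed, P(A [&] B) and P(A) P(B) are finite measures in [A] that agree on a pi-system,
    hence on the sigma-algebra it generates. This one-sided extension [half] is applied once to each
    argument. *)
Lemma indep_g_sigma_algebra (G1 G2 : set (set T)) :
  G1 `<=` measurable -> G2 `<=` measurable ->
  setI_closed G1 -> setI_closed G2 -> G1 setT -> G2 setT ->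
  (forall A B, G1 A -> G2 B -> P (A `&` B) = (P A * P B)%E) ->
  forall A B, <<s G1 >> A -> <<s G2 >> B -> P (A `&` B) = (P A * P B)%E.
Proof.
have half (G H : set (set T)) : G `<=` measurable -> setI_closed G -> G setT ->
    H `<=` measurable ->
    (forall A B, G A -> H B -> P (A `&` B) = (P A * P B)%E) ->
    forall A B, <<s G >> A -> H B -> P (A `&` B) = (P A * P B)%E.
  move=> Gm GI GT Hm GH A B GA HB.
  have mB := Hm _ HB.
  have PB0 : 0 <= fine (P B) by rewrite fine_ge0.
  have mscaleE C : mscale (NngNum PB0) P C = (P C * P B)%E.
    by rewrite /mscale/= fineK ?fin_num_measure// muleC.
  rewrite -mscaleE -[LHS]/(mrestr P mB A).
  apply: (g_sigma_algebra_measure_unique G Gm (fun=> setT)) => //.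
  - by apply/seteqP; split => // x _; exists 0%N.
  - by move=> C GC; rewrite [RHS]mscaleE -GH.
  - by move=> _; rewrite /= /mrestr setTI ltey_eq fin_num_measure.
move=> G1m G2m G1I G2I G1T G2T G12 A B sA sB.
rewrite setIC muleC; apply: (half G2 <<s G1 >>) => //.
  by apply: smallest_sub => //; exact: sigma_algebra_measurable.
by move=> {sB}B {sA}A G2B sA; rewrite setIC muleC; apply: (half G1 G2).
Qed.

End Independence.

Section Families.
Context {d : measure_display} {T : measurableType d} {R : realType}.
Context {I : finType}.
Implicit Types (K : set I) (X : I -> T -> R) (B : I -> set R).

Definition sigma_fam K X : set (set T) :=
  <<s \bigcup_(i in K) preimage_set_system [set: T] (X i) measurable >>.

(** Unlike the generators of [sigma_fam], these events are stable under intersection, so uniqueness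
    of measures applies to them. *)
Definition boxes K X : set (set T) :=
  [set A | exists2 B, (forall i, measurable (B i)) &
           A = \bigcap_(i in K) (X i @^-1` B i)].

Lemma boxesT K X : boxes K X setT.
Proof.
by exists (fun=> setT) => //; apply/esym; rewrite bigcapT// => i _; rewrite preimage_setT.
Qed.

Lemma boxes_setI K X : setI_closed (boxes K X).
Proof.
move=> _ _ [B mB ->] [C mC ->]; exists (fun i => B i `&` C i).
  by move=> i; exact: measurableI.
by rewrite -bigcapI; apply: eq_bigcapr => i _; rewrite preimage_setI.
Qed.

Lemma sigma_fam_boxes K X : sigma_fam K X = <<s boxes K X >>.
Proof.
apply/seteqP; split.
  apply: smallest_sub; first exact: smallest_sigma_algebra.
  move=> _ [i Ki [C mC <-]]; apply: sub_sigma_algebra.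
  exists (fun j => if j == i then C else setT) => [j|]; first by case: ifP.
  rewrite setTI; apply/seteqP; split => [w Cw j Kj|w /(_ i Ki)] /=.
    by case: eqP => // ->.
  by rewrite eqxx.
apply: smallest_sub; first exact: smallest_sigma_algebra.
move=> _ [B mB ->].
(* [S] is [T] with the generated sigma-algebra as its measurable structure: membership becomes
   measurability, and closure lemmas apply. *)
pose S := g_sigma_algebraType (\bigcup_(i in K)
  preimage_set_system [set: T] (X i) measurable).
have : @measurable _ S (\bigcap_(i in K) (X i @^-1` B i)).
  apply: fin_bigcap_measurable; first exact: finite_finset.
  move=> i Ki; apply: sub_sigma_algebra; exists i => //; exists (B i) => //.
  by rewrite setTI.
by [].
Qed.

Lemma boxes_measurable K X : (forall i, K i -> measurable_fun setT (X i)) ->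
  boxes K X `<=` measurable.
Proof.
move=> mX _ [B mB ->]; apply: fin_bigcap_measurable; first exact: finite_finset.
by move=> i Ki; rewrite -[X in measurable X]setTI; exact: mX.
Qed.

Variable P : probability T R.

Lemma mutual_indep_sigma_fam X (J K : {set I}) :
  (forall i, measurable_fun setT (X i)) -> mutual_indep P X ->
  fintype.disjoint (mem J) (mem K) ->
  forall A (B : set T), sigma_fam [set` J] X A -> sigma_fam [set` K] X B ->
    P (A `&` B) = (P A * P B)%E.
Proof.
move=> mX iX JK; rewrite !sigma_fam_boxes; apply: indep_g_sigma_algebra;
  try exact: boxesT; try exact: boxes_setI; try exact: boxes_measurable.
move=> _ _ [B mB ->] [C mC ->].
(* As [J] and [K] are disjoint, the two boxes glue into one box over their union, to which mutual
   independence applies. *)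
pose D i := if i \in J then B i else C i.
have mD i : measurable (D i) by rewrite /D; case: ifP.
rewrite !iX// [LHS](_ : _ = P (\bigcap_(i in [set` J :|: K]) (X i @^-1` D i))).
  rewrite iX// (eq_bigl _ _ (fun i => finset.in_setU i J K)) bigU//=.
  congr (_ * _)%E; apply: eq_bigr => i iJ.
    by rewrite /D iJ.
  by rewrite /D (disjointFl JK iJ).
congr (P _); apply/seteqP; split => [w [Bw Cw] i|w Dw].
  rewrite /= inE /D => /orP[iJ|iK].
    by rewrite iJ; exact: Bw.
  by rewrite (disjointFl JK iK); exact: Cw.
split => i /= iJ; have := Dw i; rewrite /= inE iJ ?orbT /D ?iJ; first exact.
by rewrite (disjointFl JK iJ); exact.
Qed.

End Families.

(** * Matrix spaces and Fubini for independent variables *)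

Section IndependentFubini.
Context (d d1 d2 : measure_display) (T : measurableType d)
  (T1 : measurableType d1) (T2 : measurableType d2) (R : realType).
Variables (P : probability T R) (X : T -> T1) (Y : T -> T2).
Hypotheses (mX : measurable_fun setT X) (mY : measurable_fun setT Y).
Variable D : set (T1 * T2).
Hypothesis mD : measurable D.

Let fX : {mfun T >-> T1} := HB.pack X (isMeasurableFun.Build _ _ _ _ X mX).
Let fY : {mfun T >-> T2} := HB.pack Y (isMeasurableFun.Build _ _ _ _ Y mY).

Let sectionE x :
  P [set w' | D (x, Y w')] = (distribution P fY \o xsection D) x.
Proof.
by rewrite /xsection /distribution /pushforward /=; congr (P _);
  apply/seteqP; split => w' /=; rewrite inE.
Qed.

Lemma measurable_section_prob :
  measurable_fun setT (fun w => P [set w' | D (X w, Y w')]).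
Proof.
under eq_fun do rewrite sectionE.
by apply: (measurableT_comp _ mX); exact: measurable_fun_xsection.
Qed.

(** The product rule on rectangles identifies the joint law of [X] and [Y] with the product of their
    laws; the right-hand side is that product measure of [D], computed by sections and pulled back
    along [X]. *)
Lemma independent_fubini :
  (forall A B, measurable A -> measurable B ->
     P (X @^-1` A `&` Y @^-1` B) = (P (X @^-1` A) * P (Y @^-1` B))%E) ->
  P [set w | D (X w, Y w)] = (\int[P]_w P [set w' | D (X w, Y w')])%E.
Proof.
move=> XY.
have mXY : measurable_fun setT (fun w => (X w, Y w)) by exact: measurable_fun_pair.
pose fXY : {mfun T >-> (T1 * T2)%type} :=
  HB.pack (fun w => (X w, Y w)) (isMeasurableFun.Build _ _ _ _ _ mXY).
transitivity ((distribution P fX \x distribution P fY)%E D).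
  by rewrite (@product_measure_unique _ _ _ _ _ (distribution P fX)
    (distribution P fY) (distribution P fXY)).
rewrite /product_measure1 ge0_integral_distribution//.
  by apply: eq_integral => w _; rewrite sectionE.
exact: measurable_fun_xsection.
Qed.

End IndependentFubini.

(** * Measurability of matrix operations *)

Section MatrixSpace.
Context {R : realType}.

(** A measurable type of matrices, which makes laws, product measures and Fubini available;
    [random_mx] amounts to measurability into it. *)
Definition mx_space (m n : nat) := g_sigma_algebraType
  (\bigcup_(ij in [set: 'I_m * 'I_n]) preimage_set_system [set: 'M[R]_(m, n)]
     (fun M => M ij.1 ij.2) measurable).

HB.instance Definition _ m n := Measurable.on (mx_space m n).

Lemma random_mx_coord m n : random_mx (fun M : mx_space m n => (M : 'M[R]_(m, n))).
Proof.
move=> i j _ A mA; apply: sub_sigma_algebra; exists (i, j) => //.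
by exists A.
Qed.

Lemma random_mx_measurable d (T : measurableType d) m n (M : T -> 'M[R]_(m, n)) :
  random_mx M -> measurable_fun setT (M : T -> mx_space m n).
Proof.
move=> mM; apply: measurability; first reflexivity.
move=> _ [_ [[i j] _ [B mB <-]] <-]; rewrite !setTI -[X in measurable X]setTI.
exact: (mM i j measurableT B mB).
Qed.

Lemma random_mx_fst m n m' n' :
  random_mx (fun z : mx_space m n * mx_space m' n' => z.1 : 'M[R]_(m, n)).
Proof.
move=> i j.
have mfst : measurable_fun setT
  (fst : mx_space m n * mx_space m' n' -> mx_space m n) by exact: measurable_fst.
have := measurableT_comp (random_mx_coord i j) mfst.
exact.
Qed.

Lemma random_mx_snd m n m' n' :
  random_mx (fun z : mx_space m n * mx_space m' n' => z.2 : 'M[R]_(m', n')).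
Proof.
move=> i j.
have msnd : measurable_fun setT
  (snd : mx_space m n * mx_space m' n' -> mx_space m' n') by exact: measurable_snd.
have := measurableT_comp (random_mx_coord i j) msnd.
exact.
Qed.

Lemma random_mx_comp d d' (T : measurableType d) (T' : measurableType d') m n
    (M : T' -> 'M[R]_(m, n)) (h : T -> T') : measurable_fun setT h ->
  random_mx M -> random_mx (M \o h).
Proof. by move=> mh mM i j; apply: (measurableT_comp (mM i j)). Qed.

(** Inversion is discontinuous only at 0, so the line is split into the point 0 and its open
    complement. *)
Lemma measurable_invr : measurable_fun [set: R] (@GRing.inv R).
Proof.
rewrite -(setUv [set 0 : R]); apply/measurable_funU => //.
  exact: measurableC.
split; first exact: measurable_fun_set1.
apply: open_continuous_measurable_fun => [|x].
  apply: closed_openC; apply: accessible_closed_set1.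
  exact/hausdorff_accessible/Rhausdorff.
by rewrite inE => /eqP x0; exact: inv_continuous.
Qed.

Section Closure.
Context {d : measure_display} {T : measurableType d}.
Implicit Types m n p : nat.

Lemma random_mx_cst m n (A : 'M[R]_(m, n)) : random_mx (fun _ : T => A).
Proof. by move=> i j; exact: measurable_cst. Qed.

Lemma random_mxD m n (A B : T -> 'M[R]_(m, n)) :
  random_mx A -> random_mx B -> random_mx (fun w => A w + B w).
Proof.
move=> mA mB i j; rewrite (_ : (fun w => _) = (fun w => A w i j + B w i j)).
  exact: measurable_funD.
by apply/funext => w; rewrite mxE.
Qed.

Lemma random_mxZ m n (c : T -> R) (A : T -> 'M[R]_(m, n)) :
  measurable_fun setT c -> random_mx A -> random_mx (fun w => c w *: A w).
Proof.
move=> mc mA i j; rewrite (_ : (fun w => _) = (fun w => c w * A w i j)).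
  exact: measurable_funM.
by apply/funext => w; rewrite mxE.
Qed.

Lemma random_mxN m n (A : T -> 'M[R]_(m, n)) :
  random_mx A -> random_mx (fun w => - A w).
Proof.
move=> mA; under eq_fun do rewrite -scaleN1r.
by apply: random_mxZ => //; exact: measurable_cst.
Qed.

Lemma random_mxM m n p (A : T -> 'M[R]_(m, n)) (B : T -> 'M[R]_(n, p)) :
  random_mx A -> random_mx B -> random_mx (fun w => A w *m B w).
Proof.
move=> mA mB i j.
rewrite (_ : (fun w => _) = (fun w => \sum_k A w i k * B w k j)).
  by apply: measurable_sum => k; exact: measurable_funM.
by apply/funext => w; rewrite mxE.
Qed.

Lemma random_mx_tr m n (A : T -> 'M[R]_(m, n)) :
  random_mx A -> random_mx (fun w => (A w)^T).
Proof.
move=> mA i j; rewrite (_ : (fun w => _) = (fun w => A w j i)); first exact: mA.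
by apply/funext => w; rewrite mxE.
Qed.

Lemma measurable_det n (A : T -> 'M[R]_n) :
  random_mx A -> measurable_fun setT (fun w => \det (A w)).
Proof.
move=> mA; apply: measurable_sum => s; apply: measurable_funM => //.
by apply: measurable_prod => i _; exact: mA.
Qed.

(** Cofactors express the inverse where the determinant is nonzero; elsewhere [invmx] returns the
    matrix itself. Both branches are measurable, so [col_proj] is measurable even across singular
    scores. *)
Lemma random_mx_inv n (A : T -> 'M[R]_n) :
  random_mx A -> random_mx (fun w => invmx (A w)).
Proof.
move=> mA i j.
have mD := measurable_det mA.
rewrite (_ : (fun w => _) = (fun w => if \det (A w) == 0 then A w i j else
    (\det (A w))^-1 * ((-1) ^+ (j + i) * \det (row' j (col' i (A w)))))).
  apply: measurable_fun_ifT => //=.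
  - apply: (measurable_fun_bool true).
    rewrite [X in measurable X](_ : _ = setT `&` (fun w => \det (A w)) @^-1` [set 0]).
      by apply: mD.
    by rewrite !setTI; apply/seteqP; split => w /=; [move/eqP | move->; rewrite eqxx].
  - apply: measurable_funM; first exact: (measurableT_comp measurable_invr).
  - apply: measurable_funM => //; apply: measurable_det => k l.
    rewrite (_ : (fun w => _) = (fun w => A w (lift j k) (lift i l))); first exact: mA.
    by apply/funext => w; rewrite !mxE.
apply/funext => w; rewrite /invmx unitmxE unitfE.
by case: eqP => //= _; rewrite !mxE.
Qed.
End Closure.
End MatrixSpace.

(** * Reflection invariance of the planar Gaussian law *)

Section Gaussian.
Context {R : realType}.
Notation mu := (@lebesgue_measure R).
Notation nu := (@normal_prob R 0 1).
Notation phi := (@normal_pdf R 0 1).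

(** By uniqueness of Lebesgue measure it is enough to compare half-open intervals. *)
Lemma lebesgue_measure_affine (a b : R) (A : set R) : a != 0 -> measurable A ->
  mu A = (`|a|%:E * mu ((fun y => a * y + b)%R @^-1` A))%E.
Proof.
move=> a0 mA.
have mh : measurable_fun setT ((fun y => a * y + b) : measurableTypeR R -> measurableTypeR R).
  by apply: measurable_funD => //; exact: measurable_funM.
pose h : {mfun measurableTypeR R >-> measurableTypeR R} :=
  HB.pack (fun y => a * y + b) (isMeasurableFun.Build _ _ _ _ _ mh).
apply: (@lebesgue_measure_unique R (mscale (NngNum (normr_ge0 a)) (pushforward mu h))) => //.
move=> _ [[x y] _ <-] /=.
rewrite /mscale /= [LHS]lebesgue_measure_itv /pushforward /=.
(* For negative [a] the preimage exchanges the endpoints and becomes closed on the left. *)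
move: a0; rewrite neq_lt => /orP[a0|a0].
  rewrite (_ : _ @^-1` _ = `[(y - b) / a, (x - b) / a[%classic); last first.
    apply/seteqP; split => z /=; rewrite !in_itv/= ler_ndivrMr// ltr_ndivlMr//; lra.
  rewrite lebesgue_measure_itv /= !lte_fin ltr_nM2r ?invr_lt0// ltrD2r.
  case: ifP; rewrite ?mule0// => _.
  by rewrite -!EFinB -EFinM ltr0_norm//; congr EFin; field; rewrite lt_eqF.
rewrite (_ : _ @^-1` _ = `](x - b) / a, (y - b) / a]%classic); last first.
  apply/seteqP; split => z /=; rewrite !in_itv/= ler_pdivlMr// ltr_pdivrMr//; lra.
rewrite lebesgue_measure_itv /= !lte_fin ltr_pM2r ?invr_gt0// ltrD2r.
case: ifP; rewrite ?mule0// => _.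
by rewrite -!EFinB -EFinM gtr0_norm//; congr EFin; field; rewrite gt_eqF.
Qed.

Lemma ge0_integral_affine (a b : R) (f : R -> \bar R) : a != 0 ->
  measurable_fun setT f -> (forall x, (0 <= f x)%E) ->
  (\int[mu]_x f x = `|a|%:E * \int[mu]_x f (a * x + b)%R)%E.
Proof.
move=> a0 mf f0.
have mh : measurable_fun setT ((fun y => a * y + b) : measurableTypeR R -> measurableTypeR R).
  by apply: measurable_funD => //; exact: measurable_funM.
pose h : {mfun measurableTypeR R >-> measurableTypeR R} :=
  HB.pack (fun y => a * y + b) (isMeasurableFun.Build _ _ _ _ _ mh).
rewrite (eq_measure_integral (mscale (NngNum (normr_ge0 a)) (pushforward mu h))).
  by rewrite ge0_integral_mscale//= ge0_integral_pushforward.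
by move=> A mA _; exact: (lebesgue_measure_affine b a0 mA).
Qed.

(** The Radon-Nikodym derivative of the normal law and [phi] have the same integrals over measurable
    sets, so they agree almost everywhere and can be exchanged under the integral. *)
Lemma ge0_integral_normal_prob (f : R -> \bar R) :
  measurable_fun setT f -> (forall x, (0 <= f x)%E) ->
  (\int[nu]_x f x = \int[mu]_x (f x * (phi x)%:E))%E.
Proof.
move=> mf f0.
have nu_mu : nu `<< mu by exact: normal_prob_dominates.
have mphi : measurable_fun setT (EFin \o phi).
  by apply/measurable_EFinP; exact: measurable_normal_pdf.
rewrite -(Radon_Nikodym_SigmaFinite.change_of_variables nu_mu)//.
have ig := Radon_Nikodym_SigmaFinite.f_integrable nu_mu.
apply: ge0_ae_eq_integral => //.
- by apply: emeasurable_funM => //; exact: measurable_int ig.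
- exact: emeasurable_funM.
- by move=> x _; rewrite mule_ge0// Radon_Nikodym_SigmaFinite.f_ge0.
- by move=> x _; rewrite mule_ge0// lee_fin normal_pdf_ge0.
apply: ae_eqe_mul2l; apply: integral_ae_eq => // A _ mA.
by rewrite -Radon_Nikodym_SigmaFinite.f_integral.
Qed.

Lemma measurable_lin2 (a b : R) : measurable_fun setT
  (fun z : measurableTypeR R * measurableTypeR R => a * z.1 + b * z.2).
Proof. by apply: measurable_funD; apply: measurable_funM. Qed.

Lemma measurable_reflection_preimage (c s : R) (A B : set R) :
  measurable A -> measurable B ->
  measurable ([set z | A (c * z.1 + s * z.2) /\ B (s * z.1 - c * z.2)] :
    set (measurableTypeR R * measurableTypeR R)).
Proof.
move=> mA mB.
rewrite [X in measurable X](_ : _ = (fun z => c * z.1 + s * z.2) @^-1` A `&`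
                 (fun z => s * z.1 + (- c) * z.2) @^-1` B).
  by apply: measurableI; rewrite -[X in measurable X]setTI; exact: measurable_lin2.
by apply/seteqP; split => z /=; rewrite mulNr.
Qed.

(* Substituting u = c x + s y for y and then x = s v + c u for x only uses
   one-dimensional affine changes of variable. *)
Lemma normal_prob_reflection (c s : R) (A B : set R) :
  s != 0 -> c ^+ 2 + s ^+ 2 = 1 -> measurable A -> measurable B ->
  (nu \x nu)%E [set z | A (c * z.1 + s * z.2) /\ B (s * z.1 - c * z.2)] =
  (nu A * nu B)%E.
Proof.
move=> s0 cs mA mB.
(* The joint density depends on x^2 + y^2 only, which the reflection preserves. *)
have phiE x y : phi x * phi y =
    normal_peak 1 ^+ 2 * expR (- (x ^+ 2 + y ^+ 2) / 2).
  rewrite normal_pdfE ?oner_eq0// /normal_fun mulrACA -expr2 -expRD.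
  by congr (_ * expR _); field.
have phi_ge0 x : 0 <= phi x by exact: normal_pdf_ge0.
have mphi : measurable_fun setT phi by exact: measurable_normal_pdf.
have nuE C : measurable C -> nu C = (\int[mu]_x (\1_C x * phi x)%:E)%E.
  move=> mC; rewrite /normal_prob integral_mkcond.
  apply: eq_integral => x _; rewrite patchE indicE.
  by case: ifP => _; rewrite ?mul1r ?mul0r.
have mC := measurable_reflection_preimage c s mA mB.
pose G x y : R := \1_A (c * x + s * y) * \1_B (s * x - c * y) * (phi x * phi y).
(* [H] is [G] at y = (u - c x) / s times the Jacobian; there s x - c y equals (x - c u) / s because
   c^2 + s^2 = 1. *)
pose H x u : R := `|s^-1| * (\1_A u * \1_B ((x - c * u) / s) *
                             (phi x * phi (s^-1 * u - c * x / s))).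
have mG : measurable_fun setT (fun z : measurableTypeR R * measurableTypeR R => G z.1 z.2).
  apply: measurable_funM; apply: measurable_funM.
  - exact: (measurableT_comp (measurable_indic mA) (measurable_lin2 c s)).
  - under eq_fun do rewrite -mulNr.
    exact: (measurableT_comp (measurable_indic mB) (measurable_lin2 s (- c))).
  - exact: measurableT_comp.
  - exact: measurableT_comp.
have mH : measurable_fun setT (fun z : measurableTypeR R * measurableTypeR R => H z.1 z.2).
  apply: measurable_funM => //; apply: measurable_funM; apply: measurable_funM.
  - exact: (measurableT_comp (measurable_indic mA)).
  - apply: (measurableT_comp (measurable_indic mB)).
    by apply: measurable_funM => //; apply: measurable_funB => //; exact: measurable_funM.
  - exact: measurableT_comp.
  - apply: (measurableT_comp mphi); apply: measurable_funB; first exact: measurable_funM.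
    by apply: measurable_funM => //; exact: measurable_funM.
have H_ge0 x u : 0 <= H x u by rewrite !mulr_ge0.
have G_ge0 x u : 0 <= G x u by rewrite !mulr_ge0.
transitivity (\int[mu]_x \int[mu]_y (G x y)%:E)%E.
  rewrite /product_measure1 ge0_integral_normal_prob//; last first.
    exact: measurable_fun_xsection.
  apply: eq_integral => x _ /=.
  have mxC := measurable_xsection x mC.
  rewrite nuE// -ge0_integralZr//; last 3 first.
  - by apply/measurable_EFinP; apply: measurable_funM => //; exact: measurable_indic.
  - by move=> y _; rewrite lee_fin mulr_ge0.
  - by rewrite lee_fin.
  apply: eq_integral => y _; rewrite -EFinM /G (mulrC (phi x)) mulrA; congr (_ * _ * _)%:E.
  rewrite !indicE mem_xsection -natrM mulnb; congr (nat_of_bool _)%:R.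
  by apply/idP/andP; rewrite !inE.
transitivity (\int[mu]_x \int[mu]_u (H x u)%:E)%E.
  apply: eq_integral => x _.
  rewrite (@ge0_integral_affine s^-1 (- (c * x / s))) ?invr_eq0//; last 2 first.
  - by apply/measurable_EFinP; exact: (measurableT_comp mG (measurable_pair1 x)).
  - by move=> u; rewrite lee_fin.
  rewrite -ge0_integralZl//; last 2 first.
  - apply/measurable_EFinP; apply: (measurableT_comp (measurableT_comp mG (measurable_pair1 x))).
    by apply: measurable_funD => //; exact: measurable_funM.
  - by move=> u _; rewrite lee_fin.
  apply: eq_integral => u _; rewrite -EFinM /H /G; congr (_ * (\1_A _ * \1_B _ * _))%:E.
    by field.
  by rewrite -[X in (X - _) / s]mul1r -cs; field.
(* Tonelli puts u outside, so that x can be substituted at fixed u; the new Jacobian |s| will cancel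
   the first one. *)
transitivity (\int[mu]_u \int[mu]_x (H x u)%:E)%E.
  apply: (@fubini_tonelli _ _ _ _ R mu mu (fun z => (H z.1 z.2)%:E)).
  - exact/measurable_EFinP.
  - by move=> z; rewrite lee_fin.
transitivity (\int[mu]_u \int[mu]_v (\1_A u * \1_B v * (phi u * phi v))%:E)%E.
  apply: eq_integral => u _.
  rewrite (@ge0_integral_affine s (c * u))//; last 2 first.
  - by apply/measurable_EFinP; exact: (measurableT_comp mH (measurable_pair2 u)).
  - by move=> v; rewrite lee_fin.
  rewrite -ge0_integralZl//; last 2 first.
  - apply/measurable_EFinP; apply: (measurableT_comp (measurableT_comp mH (measurable_pair2 u))).
    by apply: measurable_funD => //; exact: measurable_funM.
  - by move=> v _; rewrite lee_fin.
  apply: eq_integral => v _; rewrite -EFinM /H (mulrA `|s|) -normrM mulfV// normr1 mul1r.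
  congr (\1_A _ * \1_B _ * _)%:E; first by field.
  rewrite !phiE; congr (_ * expR (- _ / 2)).
  have -> : s^-1 * u - c * (s * v + c * u) / s = s * u - c * v.
    have -> : s^-1 * u = (c ^+ 2 + s ^+ 2) * u / s by rewrite cs; field.
    by field.
  transitivity ((c ^+ 2 + s ^+ 2) * (u ^+ 2 + v ^+ 2)); first by ring.
  by rewrite cs mul1r.
rewrite !nuE// -ge0_integralZr//; last 3 first.
- by apply/measurable_EFinP; apply: measurable_funM => //; exact: measurable_indic.
- by move=> y _; rewrite lee_fin mulr_ge0.
- by apply: integral_ge0 => y _; rewrite lee_fin mulr_ge0.
apply: eq_integral => u _; rewrite -ge0_integralZl//; last 3 first.
- by apply/measurable_EFinP; apply: measurable_funM => //; exact: measurable_indic.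
- by move=> y _; rewrite lee_fin mulr_ge0.
- by rewrite lee_fin mulr_ge0.
by apply: eq_integral => v _; rewrite -EFinM mulrACA.
Qed.
End Gaussian.

(** * Families of independent standard normal variables *)

Section IidNormal.
Context {d : measure_display} {T : measurableType d} {R : realType}.
Variable P : probability T R.
Notation nu := (@normal_prob R 0 1).

Definition iid_normal (I : finType) (X : I -> T -> R) : Prop :=
  (forall i, standard_normal P (X i)) /\ mutual_indep P X.

Lemma iid_normal_box (I : finType) (X : I -> T -> R) (J : {set I}) (B : I -> set R) :
  iid_normal X -> (forall i, measurable (B i)) ->
  P (\bigcap_(i in [set` J]) (X i @^-1` B i)) = (\prod_(i in J) nu (B i))%E.
Proof.
move=> [nX iX] mB; rewrite iX//; apply: eq_bigr => i _.
by have [_ /(_ _ (mB i))] := nX i.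
Qed.

(** Filling the missing indices with [setT], of normal mass one, gives every subfamily from full
    boxes; the one-element subfamilies give the marginal laws. *)
Lemma iid_normal_of_boxes (I : finType) (X : I -> T -> R) :
  (forall i, measurable_fun setT (X i)) ->
  (forall B : I -> set R, (forall i, measurable (B i)) ->
    P (\bigcap_i (X i @^-1` B i)) = (\prod_i nu (B i))%E) ->
  iid_normal X.
Proof.
move=> mX boxX.
have box (J : {set I}) (B : I -> set R) : (forall i, i \in J -> measurable (B i)) ->
    P (\bigcap_(i in [set` J]) (X i @^-1` B i)) = (\prod_(i in J) nu (B i))%E.
  move=> mB; pose C i := if i \in J then B i else setT.
  transitivity (P (\bigcap_i (X i @^-1` C i))).
    congr (P _); apply/seteqP; split => w Bw i.
      by rewrite /C /= => _; case: ifPn => // iJ; exact: Bw.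
    by move=> iJ; have := Bw i Logic.I; rewrite /C /= iJ.
  rewrite boxX => [|i]; last by rewrite /C; case: ifPn => // /mB.
  rewrite [RHS]big_mkcond; apply: eq_bigr => i _; rewrite /C; case: ifPn => // _.
  exact: (@probability_setT _ _ _ (normal_prob 0 1)).
have mono i (A : set R) : measurable A -> P (X i @^-1` A) = nu A.
  move=> mA; have := box [set i]%SET (fun=> A) (fun _ _ => mA).
  rewrite big_set1 => <-; congr (P _); apply/seteqP; split => w.
    by move=> Aw j /=; rewrite finset.inE => /eqP->.
  by move=> /(_ i); apply; rewrite /= finset.inE.
split => [i|J B mB]; first by split => // B mB; exact: mono.
by rewrite box//; apply: eq_bigr => i iJ; rewrite mono//; exact: mB.
Qed.

Definition reflect_pair (I : eqType) (a b : I) (c s : R) (X : I -> T -> R) : I -> T -> R :=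
  fun i w => if i == a then c * X a w + s * X b w
             else if i == b then s * X a w - c * X b w else X i w.

Lemma iid_normal_reflect (I : finType) (X : I -> T -> R) (a b : I) (c s : R) :
  a != b -> s != 0 -> c ^+ 2 + s ^+ 2 = 1 ->
  iid_normal X -> iid_normal (reflect_pair a b c s X).
Proof.
move=> ab s0 cs iX.
have mX i : measurable_fun setT (X i) by have [] := iX.1 i.
apply: iid_normal_of_boxes => [i|B mB].
  rewrite /reflect_pair; case: (i == a); last case: (i == b) => //.
    by apply: measurable_funD; exact: measurable_funM.
  by apply: measurable_funB; exact: measurable_funM.
pose K := [set a; b]%SET.
pose U := [set w | B a (c * X a w + s * X b w) /\ B b (s * X a w - c * X b w)].
pose V := \bigcap_(i in [set` (~: K)%SET]) (X i @^-1` B i).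
have prodK (F : I -> \bar R) : (\prod_(i in K) F i = F a * F b)%E.
  by rewrite /K big_setU1 ?finset.inE//= big_set1.
transitivity (P (U `&` V)).
  congr (P _); apply/seteqP; split => [w Bw|w [[Ua Ub] Vw] i _].
    split; first split.
    - by have := Bw a Logic.I; rewrite /reflect_pair /= eqxx.
    - by have := Bw b Logic.I; rewrite /reflect_pair /= eqxx eq_sym (negbTE ab).
    move=> i /=; rewrite !finset.inE negb_or => /andP[ia ib].
    by have := Bw i Logic.I; rewrite /reflect_pair /= (negbTE ia) (negbTE ib).
  rewrite /reflect_pair /=; case: eqVneq => [->//|ia]; case: eqVneq => [->//|ib].
  by apply: Vw; rewrite /= !finset.inE negb_or ia.
(* [U] depends on the coordinates [a] and [b] only and [V] on the others, so the probability factors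
   and only [U] feels the reflection. *)
rewrite (@mutual_indep_sigma_fam _ _ _ _ P X K (~: K)%SET)//; first last.
- by rewrite sigma_fam_boxes; apply: sub_sigma_algebra; exists B.
- pose S := g_sigma_algebraType (\bigcup_(i in [set` K])
    preimage_set_system [set: T] (X i) measurable).
  have mS i : i \in K -> measurable_fun [set: S] (X i).
    by move=> iK _ A mA; apply: sub_sigma_algebra; exists i => //; exists A.
  have aK : a \in K by rewrite !finset.inE eqxx.
  have bK : b \in K by rewrite !finset.inE eqxx orbT.
  have : @measurable _ S U.
    rewrite (_ : U = (fun w => c * X a w + s * X b w) @^-1` B a `&`
                     (fun w => s * X a w - c * X b w) @^-1` B b)//.
    apply: measurableI; rewrite -[Y in measurable Y]setTI.
      have : measurable_fun [set: S] (fun w => c * X a w + s * X b w).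
        by apply: measurable_funD; apply: measurable_funM => //; exact: mS.
      exact.
    have : measurable_fun [set: S] (fun w => s * X a w - c * X b w).
      by apply: measurable_funB; apply: measurable_funM => //; exact: mS.
    exact.
  by [].
- by rewrite finset.disjoints_subset finset.setCK.
- exact: iX.2.
rewrite (iid_normal_box _ iX mB).
rewrite [in RHS](bigID (mem K))/= prodK.
rewrite [in RHS](eq_bigl (fun i => i \in (~: K)%SET)); last first.
  by move=> i; rewrite finset.in_setC.
congr (_ * _)%E.
(* It remains to see that the law of the pair of coordinates [a], [b] is the planar normal law,
   which is checked on rectangles. *)
rewrite -(normal_prob_reflection s0 cs (mB a) (mB b)).
pose XX w : measurableTypeR R * measurableTypeR R := (X a w, X b w).
have mXX : measurable_fun setT XX by apply: measurable_fun_pair; exact: mX.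
pose fXX : {mfun T >-> (measurableTypeR R * measurableTypeR R)%type} :=
  HB.pack XX (isMeasurableFun.Build _ _ _ _ _ mXX).
rewrite (@product_measure_unique _ _ _ _ _ (normal_prob 0 1) (normal_prob 0 1)
  (distribution P fXX))//.
- move=> C D mC mD.
  have := @iid_normal_box _ X K (fun i => if i == a then C else D) iX.
  rewrite prodK eqxx eq_sym (negbTE ab) => <-.
    congr (P _); apply/seteqP; split => [w [Cw Dw] i|w CD].
      by rewrite /= !finset.inE => /orP[] /eqP->; rewrite ?eqxx// eq_sym (negbTE ab).
    have := CD a; have := CD b.
    by rewrite /= !finset.inE !eqxx orbT eq_sym (negbTE ab); split; auto.
  by move=> i; case: ifP.
exact: measurable_reflection_preimage.
Qed.

End IidNormal.

(** * Triangularization by planar reflections *)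

Section Reflections.
Context {R : realType}.

(** For distinct [a] and [b] the nontrivial block has rows (c, s) and (s, -c): it is symmetric and,
    when c^2 + s^2 = 1, its own inverse. *)
Definition reflection_mx n (a b : 'I_n) (c s : R) : 'M[R]_n :=
  \matrix_(i, j) if i == a then c * (j == a)%:R + s * (j == b)%:R
                 else if i == b then s * (j == a)%:R - c * (j == b)%:R
                 else (j == i)%:R.

Lemma mul_reflection_mxE n m (a b : 'I_n) (c s : R) (A : 'M[R]_(n, m)) i j :
  (reflection_mx a b c s *m A) i j =
    if i == a then c * A a j + s * A b j
    else if i == b then s * A a j - c * A b j else A i j.
Proof.
have sum_delta (k : 'I_n) : \sum_l (l == k)%:R * A l j = A k j.
  rewrite (bigD1 k)//= eqxx mul1r big1 ?addr0// => l /negbTE->.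
  by rewrite mul0r.
rewrite mxE; under eq_bigr do rewrite mxE.
case: eqP => _; last case: eqP => _.
- under eq_bigr do rewrite mulrDl -!mulrA.
  by rewrite big_split/= -!mulr_sumr !sum_delta.
- under eq_bigr do rewrite mulrBl -!mulrA.
  by rewrite big_split/= sumrN -!mulr_sumr !sum_delta.
- exact: sum_delta.
Qed.

Lemma reflection_mx_tr n (a b : 'I_n) (c s : R) : a != b ->
  (reflection_mx a b c s)^T = reflection_mx a b c s.
Proof.
move=> ab; apply/matrixP => i j; rewrite !mxE.
case: (eqVneq i a) => [->|ia]; case: (eqVneq j a) => [->|ja];
  rewrite ?eqxx ?(negbTE ab) //.
- by case: eqVneq; rewrite ?mulr0 ?mulr1 ?addr0 ?add0r ?subr0.
- case: eqVneq; rewrite ?mulr0 ?mulr1 ?addr0 ?add0r ?subr0// => _.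
  by rewrite eq_sym (negbTE ia).
case: (eqVneq i b) => [->|ib]; case: (eqVneq j b) => [jb|jb];
  rewrite ?eqxx ?mulr0 ?subr0 ?oppr0//; last by rewrite eq_sym.
by rewrite jb eq_sym (negbTE ib).
Qed.

Lemma reflection_mx_orth n (a b : 'I_n) (c s : R) : a != b ->
  c ^+ 2 + s ^+ 2 = 1 ->
  (reflection_mx a b c s)^T *m reflection_mx a b c s = 1%:M.
Proof.
move=> ab cs; rewrite reflection_mx_tr//; apply/matrixP => i j.
rewrite mul_reflection_mxE !mxE !eqxx (eq_sym b a) (negbTE ab).
case: eqP => [->|_]; last case: eqP => [->|//].
- transitivity ((c ^+ 2 + s ^+ 2) * (j == a)%:R : R); first by ring.
  by rewrite cs mul1r eq_sym.
- transitivity ((c ^+ 2 + s ^+ 2) * (j == b)%:R : R); first by ring.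
  by rewrite cs mul1r eq_sym.
- by move=> _; rewrite eq_sym.
Qed.

(** An inductive class, so that orthogonality and Gaussian invariance pass to products. The
    condition on [s] is what lets the planar substitution divide by [s]. *)
Inductive reflection_prod n : 'M[R]_n -> Prop :=
| reflection_prod1 : reflection_prod 1%:M
| reflection_prodM (a b : 'I_n) (c s : R) (Q : 'M[R]_n) :
    a != b -> s != 0 -> c ^+ 2 + s ^+ 2 = 1 -> reflection_prod Q ->
    reflection_prod (reflection_mx a b c s *m Q).

Lemma reflection_prod_orth n (Q : 'M[R]_n) :
  reflection_prod Q -> Q^T *m Q = 1%:M.
Proof.
elim=> [|a b c s {}Q ab s0 cs _ IH]; first by rewrite trmx1 mulmx1.
by rewrite trmx_mul -mulmxA [X in _ *m X]mulmxA reflection_mx_orth// mul1mx.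
Qed.

Lemma triangularize n m (A : 'M[R]_(n, m)) : exists2 Q : 'M[R]_n,
  reflection_prod Q &
  forall (i : 'I_n) (j : 'I_m), (j < i)%N -> (Q *m A) i j = 0.
Proof.
(* Givens elimination: the outer induction clears columns from left to right, the inner one clears
   column k row by row, always against the pivot row k. *)
suff: forall k, (k <= m)%N -> exists2 Q : 'M[R]_n, reflection_prod Q &
    forall (i : 'I_n) (j : 'I_m), (j < k)%N -> (j < i)%N -> (Q *m A) i j = 0.
  by move=> /(_ m (leqnn m)) [Q rQ QA]; exists Q => // i j; exact: QA.
elim=> [_|k IHk km].
  by exists 1%:M => //; exact: reflection_prod1.
suff: forall l, (l <= n)%N -> exists2 Q : 'M[R]_n, reflection_prod Q &
    (forall (i : 'I_n) (j : 'I_m), (j < k)%N -> (j < i)%N -> (Q *m A) i j = 0) /\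
    (forall i : 'I_n, (k < i)%N -> (i < l)%N -> (Q *m A) i (Ordinal km) = 0).
  move=> /(_ n (leqnn n)) [Q rQ [QA QAk]]; exists Q => // i j.
  rewrite ltnS leq_eqVlt => /orP[/eqP jk ji|]; last exact: QA.
  have -> : j = Ordinal km by exact: val_inj.
  by apply: QAk => //; rewrite -jk.
elim=> [_|l IHl ln].
  by have [Q rQ QA] := IHk (ltnW km); exists Q.
have [Q rQ [QA QAk]] := IHl (ltnW ln).
have [lk|kl] := leqP l k.
  exists Q => //; split => // i ki; rewrite ltnS => il.
  by have := leq_trans ki (leq_trans il lk); rewrite ltnn.
pose a := Ordinal (ltn_trans kl ln); pose b := Ordinal ln; pose k' := Ordinal km.
have ab : a != b by rewrite -val_eqE /= ltn_eqF.
set x := (Q *m A) a k'; set y := (Q *m A) b k'.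
(* An entry that is already zero is skipped, which guarantees s != 0 in every reflection used. *)
have [y0|y0] := eqVneq y 0.
  exists Q => //; split => // i ki; rewrite ltnS leq_eqVlt => /orP[/eqP il|].
    by have -> : i = b by exact: val_inj.
  exact: QAk.
(* With c = x / rho and s = y / rho the pair (x, y) is sent to (rho, 0). *)
pose rho := Num.sqrt (x ^+ 2 + y ^+ 2).
have y2 : 0 < y ^+ 2 by rewrite exprn_even_gt0.
have xy0 : 0 < x ^+ 2 + y ^+ 2 by rewrite ltr_wpDl// sqr_ge0.
have rho2 : rho ^+ 2 = x ^+ 2 + y ^+ 2 by rewrite sqr_sqrtr// ltW.
have rho0 : rho != 0 by rewrite gt_eqF// sqrtr_gt0.
exists (reflection_mx a b (x / rho) (y / rho) *m Q).
  apply: reflection_prodM => //; first by rewrite mulf_neq0// invr_neq0.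
  by rewrite !expr_div_n -mulrDl rho2 divff// gt_eqF.
(* In a column j < k the rows [a] and [b] both lie below the diagonal, so the reflection combines
   zeros. *)
split=> [i j jk ji|i ki]; rewrite -mulmxA mul_reflection_mxE.
  rewrite !(QA _ _ jk) //=; first by rewrite !mulr0 subrr addr0 !if_same.
  exact: (ltn_trans jk kl).
have -> : (i == a) = false by rewrite -val_eqE /= gtn_eqF.
rewrite ltnS leq_eqVlt => /orP[/eqP il|il].
  have -> : (i == b) = true by rewrite -val_eqE /= il eqxx.
  by rewrite -/k' -/x -/y; ring.
have -> : (i == b) = false by rewrite -val_eqE /= ltn_eqF.
exact: QAk.
Qed.

End Reflections.

(** * Centering and projections *)

Section Projections.
Context {R : realType}.

Lemma mxtrace_gram n m (A : 'M[R]_(n, m)) :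
  \tr (A^T *m A) = \sum_j \sum_i A i j ^+ 2.
Proof.
apply: eq_bigr => j _; rewrite mxE; apply: eq_bigr => i _.
by rewrite mxE expr2.
Qed.

Lemma mxtrace_gram_ge0 n m (A : 'M[R]_(n, m)) : 0 <= \tr (A^T *m A).
Proof. by rewrite mxtrace_gram; do 2 (apply: sumr_ge0 => ? _); exact: sqr_ge0. Qed.

Lemma mxtrace_gram_eq0 n m (A : 'M[R]_(n, m)) : \tr (A^T *m A) = 0 -> A = 0.
Proof.
rewrite mxtrace_gram => /eqP; rewrite psumr_eq0 => [/allP A0|j _]; last first.
  by apply: sumr_ge0 => i _; exact: sqr_ge0.
apply/matrixP => i j; rewrite mxE.
have := A0 j (mem_index_enum j); rewrite /= psumr_eq0 => [/allP/(_ i)|k _].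
  by rewrite mem_index_enum sqrf_eq0 => /(_ isT)/eqP.
exact: sqr_ge0.
Qed.

(** A row vector [v] killed by the Gram matrix satisfies |v F^T|^2 = v F^T F v^T = 0, and [F^T] has
    independent rows. *)
Lemma gram_unitmx n r (F : 'M[R]_(n, r)) : \rank F = r -> F^T *m F \in unitmx.
Proof.
move=> rF; rewrite -row_free_unit; apply/inj_row_free => v vFF0.
have FT : row_free F^T by rewrite /row_free mxrank_tr rF.
apply: (row_free_inj FT); rewrite mul0mx; apply: trmx_inj; rewrite trmx0.
apply: mxtrace_gram_eq0.
by rewrite trmxK trmx_mul trmxK mulmxA -(mulmxA v) vFF0 mul0mx mxtrace0.
Qed.

Section ColProj.
Variables (n r : nat) (F : 'M[R]_(n, r)).
Hypothesis rF : \rank F = r.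

Lemma col_proj_id : col_proj F *m F = F.
Proof. by rewrite /col_proj -!mulmxA mulVmx ?mulmx1// gram_unitmx. Qed.

Lemma col_proj_tr : (col_proj F)^T = col_proj F.
Proof.
by rewrite /col_proj !trmx_mul trmxK trmx_inv trmx_mul trmxK mulmxA.
Qed.

Lemma col_proj_idem : col_proj F *m col_proj F = col_proj F.
Proof. by rewrite {2}/col_proj !mulmxA col_proj_id. Qed.

Lemma mxtrace_col_proj : \tr (col_proj F) = r%:R.
Proof. by rewrite /col_proj -mulmxA mxtrace_mulC -mulmxA mulVmx ?gram_unitmx// mxtrace1. Qed.

End ColProj.

Definition centering_mx n : 'M[R]_n :=
  1%:M - n%:R^-1 *: (const_mx 1 : 'cV_n) *m (const_mx 1 : 'cV_n)^T.

Lemma centered_mxE n p (X : 'I_n -> 'cV[R]_p) :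
  centered_mx X = centering_mx n *m rows_mx X.
Proof.
apply/matrixP => i j; rewrite mulmxBl mul1mx !mxE; congr (_ - _).
rewrite summxE mulr_sumr; apply: eq_bigr => k _.
by rewrite !mxE big_ord1 !mxE !mulr1.
Qed.

Lemma rows_observation n p d r (mu : 'cV[R]_p) (Gamma : 'M[R]_(p, d))
    (beta : 'M[R]_(d, r)) (sigma : R) (f : 'I_n -> 'cV[R]_r) (e : 'I_n -> 'cV[R]_p) :
  rows_mx (fun i => observation mu Gamma beta sigma (f i) (e i)) =
  (const_mx 1 : 'cV_n) *m mu^T + rows_mx f *m (Gamma *m beta)^T + sigma *: rows_mx e.
Proof.
apply/matrixP => i j; rewrite !mxE; congr (_ + _ + _).
- by rewrite big_ord1 !mxE mul1r.
- by apply: eq_bigr => k _; rewrite ![in RHS]mxE [in LHS]mxE mulrC.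
Qed.

(** This is the trace of [pid_mx k] in size n; the minimum covers k > n. *)
Lemma sum_ord_ltn (n k : nat) : (\sum_(i < n) (i < k)%N)%N = minn n k.
Proof. by elim: n => [|n IH]; rewrite ?big_ord0 ?min0n// big_ord_recr/= IH; lia. Qed.

Section Regular.
Variables (n r : nat) (F : 'M[R]_(n, r)).
Hypothesis n_gt0 : (0 < n)%N.
Hypothesis rF : \rank F = r.
Let o : 'cV[R]_n := const_mx 1.
Hypothesis F1 : F^T *m o = 0.

Let oo : o^T *m o = n%:R%:M.
Proof.
apply/matrixP => i j; rewrite !mxE !ord1 eqxx.
by under eq_bigr do rewrite !mxE mulr1; rewrite sumr_const card_ord.
Qed.

Let n0 : n%:R != 0 :> R. Proof. by rewrite pnatr_eq0 -lt0n. Qed.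

Let C := n%:R^-1 *: o *m o^T.

Let Co : C *m o = o.
Proof. by rewrite -mulmxA oo mul_mx_scalar scalerA divff// scale1r. Qed.

Let CC : C *m C = C.
Proof. by rewrite {2}/C mulmxA -scalemxAr Co. Qed.

Let CT : C^T = C.
Proof. by rewrite /C trmx_mul trmxK linearZ/= -scalemxAl -scalemxAr. Qed.

Lemma col_proj_const : col_proj F *m o = 0.
Proof. by rewrite /col_proj -mulmxA F1 mulmx0. Qed.

Lemma centering_mx_const : centering_mx n *m o = 0.
Proof. by rewrite mulmxBl mul1mx Co subrr. Qed.

Lemma centering_mx_tr : (centering_mx n)^T = centering_mx n.
Proof. by rewrite /centering_mx linearB/= trmx1 CT. Qed.

Lemma centering_mx_idem : centering_mx n *m centering_mx n = centering_mx n.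
Proof.
have oH : o^T *m centering_mx n = 0.
  by apply: trmx_inj; rewrite trmx_mul trmxK centering_mx_tr centering_mx_const trmx0.
by rewrite {1}/centering_mx mulmxBl mul1mx -mulmxA oH mulmx0 subr0.
Qed.

Lemma col_proj_centering : col_proj F *m centering_mx n = col_proj F.
Proof.
by rewrite mulmxBr mulmx1 -/o -scalemxAl -scalemxAr mulmxA col_proj_const
  mul0mx scaler0 subr0.
Qed.

Lemma centering_mx_regular : centering_mx n *m F = F.
Proof.
rewrite mulmxBl mul1mx -/o -mulmxA -(trmxK (o^T *m F)) trmx_mul trmxK F1.
by rewrite trmx0 mulmx0 subr0.
Qed.

(** The projection [L] = Q^T D Q fixes the constants and the columns of [F], so it dominates the
    projection [K] = C + P_F onto their span. Its trace is at most r + 1 = tr K, which forces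
    equality. *)
Lemma residual_rotation : exists2 Q : 'M[R]_n, reflection_prod Q &
  centering_mx n - col_proj F = Q^T *m copid_mx r.+1 *m Q /\
  col_proj F = col_proj F *m Q^T *m pid_mx r.+1 *m Q.
Proof.
have [Q rQ QA] := triangularize (row_mx o F).
exists Q => //.
have QQ := reflection_prod_orth rQ.
have QQ' : Q *m Q^T = 1%:M by exact: mulmx1C.
pose D : 'M[R]_n := pid_mx r.+1.
(* An upper triangular matrix with r + 1 columns has zero rows from index r + 1 on. *)
have DQA : D *m (Q *m row_mx o F) = Q *m row_mx o F.
  apply/matrixP => i j; rewrite mxE (bigD1 i)//= big1 ?addr0 => [|k ki].
    rewrite mxE eqxx/=; case: ltnP => ir; first by rewrite mul1r.
    by rewrite QA ?mulr0// (leq_trans _ ir).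
  by rewrite mxE eq_sym val_eqE (negbTE ki)/= mul0r.
pose L := Q^T *m D *m Q.
have : L *m row_mx o F = row_mx o F by rewrite /L -!mulmxA DQA mulmxA QQ mul1mx.
rewrite mul_mx_row => /eq_row_mx[Lo LF].
have LT : L^T = L by rewrite /L !trmx_mul trmxK tr_pid_mx mulmxA.
have LL : L *m L = L.
  by rewrite /L -!mulmxA (mulmxA Q) QQ' mul1mx (mulmxA D) mul_pid_mx minnn pid_mx_minv.
have PL : col_proj F = col_proj F *m L.
  rewrite -[RHS]trmxK trmx_mul LT col_proj_tr {2}/col_proj !mulmxA LF.
  by rewrite -/(col_proj F) col_proj_tr.
split; last by rewrite {1}PL !mulmxA.
pose K := C + col_proj F.
have LK : L *m K = K.
  rewrite mulmxDr; congr (_ + _); first by rewrite /C mulmxA -scalemxAr Lo.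
  by rewrite /col_proj !mulmxA LF.
have KT : K^T = K by rewrite /K linearD/= CT col_proj_tr.
have KL : K *m L = K by rewrite -[LHS]trmxK trmx_mul LT KT LK.
have CP : C *m col_proj F = 0.
  apply: trmx_inj; rewrite trmx_mul CT col_proj_tr trmx0 /C mulmxA -scalemxAr.
  by rewrite col_proj_const scaler0 mul0mx.
have PC : col_proj F *m C = 0.
  by apply: trmx_inj; rewrite trmx_mul CT col_proj_tr CP trmx0.
have KK : K *m K = K.
  by rewrite /K mulmxDr !mulmxDl CC PC CP addr0 add0r col_proj_idem.
(* Being its own Gram matrix, L - K has a sum of squares as trace; once this is also at most 0, L -
   K vanishes. *)
have LKgram : (L - K)^T *m (L - K) = L - K.
  have -> : (L - K)^T = L^T - K^T by exact: linearB.
  by rewrite LT KT mulmxBr !mulmxBl LL LK KL KK subrr subr0.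
have trK : \tr K = r.+1%:R.
  rewrite /K mxtraceD mxtrace_col_proj// /C.
  rewrite (mxtrace_mulC (n%:R^-1 *: o) o^T) -scalemxAr oo.
  by rewrite scale_scalar_mx mulVf// mxtrace1 -natrD add1n.
have trL : \tr L <= r.+1%:R.
  rewrite /L -mulmxA mxtrace_mulC -mulmxA QQ' mulmx1 /mxtrace.
  under eq_bigr do rewrite mxE eqxx/=.
  by rewrite -natr_sum ler_nat sum_ord_ltn geq_minr.
have LK0 : L - K = 0.
  apply: mxtrace_gram_eq0; apply/eqP; rewrite eq_le mxtrace_gram_ge0 andbT.
  by rewrite LKgram linearB/= trK subr_le0.
have LeK : L = K by apply/eqP; rewrite -subr_eq0 LK0.
have -> : copid_mx r.+1 = 1%:M - D by [].
by rewrite mulmxBr mulmxBl mulmx1 QQ -/L LeK /K opprD addrA.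
Qed.
End Regular.
End Projections.

(** * Laws of Gaussian matrices *)

Section Boxes.
Context {R : realType} {m n : nat}.

Definition in_box (A : 'I_m * 'I_n -> set R) (M : 'M[R]_(m, n)) : Prop :=
  forall ij, A ij (M ij.1 ij.2).

Lemma box_eventE (T : Type) (A : 'I_m * 'I_n -> set R) (M : T -> 'M[R]_(m, n)) :
  \bigcap_ij ((fun w => M w ij.1 ij.2) @^-1` A ij) = [set w | in_box A (M w)].
Proof. by apply/seteqP; split => w Mw ij => [|_]; exact: Mw. Qed.

Lemma measurable_box_event d (T : measurableType d) (A : 'I_m * 'I_n -> set R)
    (M : T -> 'M[R]_(m, n)) : (forall ij, measurable (A ij)) -> random_mx M ->
  measurable [set w | in_box A (M w)].
Proof.
move=> mA mM; rewrite -box_eventE.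
apply: (@boxes_measurable _ _ _ _ setT (fun ij w => M w ij.1 ij.2)) => [ij _|].
  exact: mM.
by exists A.
Qed.

End Boxes.

Section MatrixIndep.
Context {d : measure_display} {T : measurableType d} {R : realType}.
Variable P : probability T R.

Lemma indep_mx_boxes m n m' n' (M : T -> 'M[R]_(m, n)) (M' : T -> 'M[R]_(m', n')) :
  random_mx M -> random_mx M' ->
  (forall A B, (forall ij, measurable (A ij)) -> (forall ij, measurable (B ij)) ->
    P [set w | in_box A (M w) /\ in_box B (M' w)] =
    (P [set w | in_box A (M w)] * P [set w | in_box B (M' w)])%E) ->
  indep_mx P M M'.
Proof.
move=> mM mM' MM'.
(* [sigma_mx] is [sigma_fam] over all entries, up to conversion. *)
suff : forall A B, sigma_fam setT (fun ij w => M w ij.1 ij.2) A ->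
    sigma_fam setT (fun ij w => M' w ij.1 ij.2) B -> P (A `&` B) = (P A * P B)%E.
  exact.
rewrite !sigma_fam_boxes; apply: indep_g_sigma_algebra;
  try exact: boxesT; try exact: boxes_setI.
- by apply: boxes_measurable => ij _; exact: mM.
- by apply: boxes_measurable => ij _; exact: mM'.
by move=> _ _ [A mA ->] [B mB ->]; rewrite !box_eventE; exact: MM'.
Qed.

(** [M] is measurable for its own sigma-algebra, so [indep_mx] yields the product rule on preimages,
    the form that Fubini uses. *)
Lemma sigma_mx_preimage m n (M : T -> 'M[R]_(m, n)) (A : set (mx_space m n)) :
  measurable A -> sigma_mx M (M @^-1` A).
Proof.
move=> mA.
pose S := g_sigma_algebraType (\bigcup_(ij in [set: 'I_m * 'I_n])
  preimage_set_system [set: T] (fun w => M w ij.1 ij.2) measurable).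
have mM : @random_mx _ S R m n M.
  move=> i j _ B mB; apply: sub_sigma_algebra; exists (i, j) => //.
  by exists B.
have := random_mx_measurable mM measurableT mA.
by rewrite setTI.
Qed.

Definition mx_entries m n (M : T -> 'M[R]_(m, n)) : 'I_m * 'I_n -> T -> R :=
  fun ij w => M w ij.1 ij.2.

Lemma iid_normal_random_mx m n (M : T -> 'M[R]_(m, n)) :
  iid_normal P (mx_entries M) -> random_mx M.
Proof. by move=> [nM _] i j; have [] := nM (i, j). Qed.

(** Both laws agree on boxes. Taken with [Z] = Q E, this removes [Q], and with it the scores, from
    the law of the residual. *)
Lemma iid_normal_law m n (E Z : T -> 'M[R]_(m, n)) :
  iid_normal P (mx_entries E) -> iid_normal P (mx_entries Z) ->
  forall D : set (mx_space m n), measurable D ->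
    P [set w | D (E w)] = P [set w | D (Z w)].
Proof.
move=> iE iZ D mD.
have mE := random_mx_measurable (iid_normal_random_mx iE).
have mZ := random_mx_measurable (iid_normal_random_mx iZ).
pose fE : {mfun T >-> mx_space m n} :=
  HB.pack (E : T -> mx_space m n) (isMeasurableFun.Build _ _ _ _ _ mE).
pose fZ : {mfun T >-> mx_space m n} :=
  HB.pack (Z : T -> mx_space m n) (isMeasurableFun.Build _ _ _ _ _ mZ).
pose G := boxes setT (fun (ij : 'I_m * 'I_n) (M : mx_space m n) => M ij.1 ij.2 : R).
have mG : measurable = <<s G >> by rewrite -sigma_fam_boxes.
apply: (@measure_unique _ _ _ G (fun=> setT) mG _ _ _
  (distribution P fE) (distribution P fZ)) => //.
- exact: boxes_setI.
- by move=> _; exact: boxesT.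
- by apply/seteqP; split => // x _; exists 0%N.
- move=> _ [B mB ->].
  transitivity (\prod_ij normal_prob 0 1 (B ij))%E.
    have := iid_normal_box [set: _]%SET iE mB.
    under eq_bigl do rewrite finset.inE; move=> <-; congr (P _).
    by apply/seteqP; split => w Bw ij // _; apply: Bw; rewrite //= finset.inE.
  have := iid_normal_box [set: _]%SET iZ mB.
  under eq_bigl do rewrite finset.inE; move=> <-; congr (P _).
  by apply/seteqP; split => w Bw ij // _; apply: Bw; rewrite //= finset.inE.
- by move=> _; rewrite ltey_eq fin_num_measure.
Qed.

Lemma iid_normal_reflection_mx m n (Z : T -> 'M[R]_(m, n)) (a b : 'I_m) (c s : R) :
  a != b -> s != 0 -> c ^+ 2 + s ^+ 2 = 1 -> iid_normal P (mx_entries Z) ->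
  iid_normal P (mx_entries (fun w => reflection_mx a b c s *m Z w)).
Proof.
move=> ab s0 cs iZ.
(* [Y k] has its first k columns reflected; passing to k + 1 reflects a single pair of entries. *)
pose Y k : 'I_m * 'I_n -> T -> R := fun ij w => if (ij.2 < k)%N
  then (reflection_mx a b c s *m Z w) ij.1 ij.2 else Z w ij.1 ij.2.
have YE : Y n = mx_entries (fun w => reflection_mx a b c s *m Z w).
  by apply/funext => -[i j]; apply/funext => w; rewrite /Y /= ltn_ord.
suff iY : forall k, (k <= n)%N -> iid_normal P (Y k) by rewrite -YE; exact: iY.
elim=> [_|k IHk kn]; first exact: iZ.
have -> : Y k.+1 = reflect_pair (a, Ordinal kn) (b, Ordinal kn) c s (Y k).
  apply/funext => -[i j]; apply/funext => w.
  rewrite /reflect_pair /Y /= ltnn ltnS leq_eqVlt !xpair_eqE !mul_reflection_mxE.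
  have [->|jk] := eqVneq j (Ordinal kn); first by rewrite /= eqxx !andbT ltnn.
  by rewrite !andbF; move: jk; rewrite -val_eqE /= => /negbTE ->.
apply: iid_normal_reflect => //; last exact: IHk (ltnW kn).
by rewrite xpair_eqE negb_and ab.
Qed.

Lemma iid_normal_reflection_prod m n (E : T -> 'M[R]_(m, n)) (Q : 'M[R]_m) :
  reflection_prod Q -> iid_normal P (mx_entries E) ->
  iid_normal P (mx_entries (fun w => Q *m E w)).
Proof.
move=> rQ iE; elim: rQ => [|a b c s {}Q ab s0 cs _ iQE].
  by under eq_fun do rewrite mul1mx.
have -> : (fun w => reflection_mx a b c s *m Q *m E w) =
    (fun w => reflection_mx a b c s *m (Q *m E w)).
  by apply/funext => w; rewrite mulmxA.
exact: iid_normal_reflection_mx.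
Qed.

(** [pid_mx k] keeps the rows of index below k and [copid_mx k] the others: two disjoint blocks of
    independent entries. *)
Lemma iid_normal_split m n m1 n1 m2 n2 (Z : T -> 'M[R]_(m, n)) (k : nat)
    (g : 'M[R]_(m, n) -> 'M[R]_(m1, n1)) (h : 'M[R]_(m, n) -> 'M[R]_(m2, n2))
    (A : 'I_m1 * 'I_n1 -> set R) (B : 'I_m2 * 'I_n2 -> set R) :
  iid_normal P (mx_entries Z) ->
  (forall ij, measurable (A ij)) -> (forall ij, measurable (B ij)) ->
  random_mx (fun M : mx_space m n => g M) -> random_mx (fun M : mx_space m n => h M) ->
  P [set w | in_box A (g (copid_mx k *m Z w)) /\ in_box B (h (pid_mx k *m Z w))] =
  (P [set w | in_box A (g (copid_mx k *m Z w))] *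
   P [set w | in_box B (h (pid_mx k *m Z w))])%E.
Proof.
move=> iZ mA mB mg mh.
have mZ := iid_normal_random_mx iZ.
pose K := [set ij : 'I_m * 'I_n | (ij.1 < k)%N]%SET.
pose S (J : {set 'I_m * 'I_n}) := g_sigma_algebraType (\bigcup_(ij in [set` J])
  preimage_set_system [set: T] (mx_entries Z ij) measurable).
have pidE w i j : ((pid_mx k : 'M[R]_m) *m Z w) i j = if (i < k)%N then Z w i j else 0.
  rewrite mxE (bigD1 i)//= big1 ?addr0 => [|l li].
    by rewrite mxE eqxx/=; case: ifP; rewrite ?mul1r ?mul0r.
  by rewrite mxE eq_sym val_eqE (negbTE li)/= mul0r.
have mpid : @random_mx _ (S K) R m n (fun w => pid_mx k *m Z w).
  move=> i j.
  have -> : (fun w => ((pid_mx k : 'M[R]_m) *m Z w) i j) =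
      (fun w => if (i < k)%N then Z w i j else 0) by apply/funext.
  case ik: (i < k)%N; last exact: measurable_cst.
  move=> _ C mC; apply: sub_sigma_algebra; exists (i, j); first by rewrite /= finset.inE.
  by exists C.
have mcopid : @random_mx _ (S (~: K)%SET) R m n (fun w => copid_mx k *m Z w).
  move=> i j.
  have -> : (fun w => ((copid_mx k : 'M[R]_m) *m Z w) i j) =
      (fun w => if (i < k)%N then 0 else Z w i j).
    apply/funext => w; rewrite /copid_mx mulmxBl mul1mx mxE mxE pidE.
    by case: ifP => _; rewrite ?subrr ?subr0.
  case ik: (i < k)%N; first exact: measurable_cst.
  move=> _ C mC; apply: sub_sigma_algebra; exists (i, j); first by rewrite /= !finset.inE ik.
  by exists C.
rewrite [LHS](_ : _ = P ([set w | in_box A (g (copid_mx k *m Z w))] `&`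
                        [set w | in_box B (h (pid_mx k *m Z w))]))//.
apply: (@mutual_indep_sigma_fam _ _ _ _ P (mx_entries Z) (~: K)%SET K).
- by move=> ij; exact: mZ.
- exact: iZ.2.
- by rewrite finset.disjoints_subset.
- exact: (measurable_box_event (T := S (~: K)%SET) mA
    (random_mx_comp (random_mx_measurable mcopid) mg)).
- exact: (measurable_box_event (T := S K) mB
    (random_mx_comp (random_mx_measurable mpid) mh)).
Qed.

End MatrixIndep.

(** * Residual and fitted matrices *)

Lemma copid_mx_gram (R : comNzRingType) (n k : nat) :
  (copid_mx k)^T *m copid_mx k = copid_mx k :> 'M[R]_n.
Proof.
rewrite /copid_mx; have -> : (1%:M - pid_mx k)^T = 1%:M - pid_mx k :> 'M[R]_n.
  by rewrite linearB/= trmx1 tr_pid_mx.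
by rewrite mulmxBr mulmx1 mulmxBl mul1mx mul_pid_mx minnn pid_mx_minv subrr subr0.
Qed.

Section FixedScores.
Context {d : measure_display} {T : measurableType d} {R : realType}.
Variable P : probability T R.
Variables (n p r : nat).

Definition residual_mx (sigma : R) (F : 'M[R]_(n, r)) (e : 'M[R]_(n, p)) : 'M[R]_p :=
  sigma ^+ 2 *: (e^T *m (centering_mx n - col_proj F) *m e).

Variables (E : T -> 'M[R]_(n, p)) (sigma : R) (mu : 'cV[R]_p) (G : 'M[R]_(p, r)).

(** Scores and errors are separate arguments, so that [F] can be frozen while the errors are
    integrated. *)
Definition fitted_of (F : 'M[R]_(n, r)) (e : 'M[R]_(n, p)) : 'M[R]_(n, p) :=
  col_proj F *m (centering_mx n *m
    ((const_mx 1 : 'cV_n) *m mu^T + F *m G^T + sigma *: e)).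

Hypothesis n_gt0 : (0 < n)%N.
Hypothesis iE : iid_normal P (mx_entries E).

(** The first factor is written with [E] instead of Q E, and so is the same for all regular [F]. *)
Lemma residual_fitted_indep_fixed (F : 'M[R]_(n, r)) A B :
  \rank F = r -> F^T *m (const_mx 1 : 'cV_n) = 0 ->
  (forall ij, measurable (A ij)) -> (forall ij, measurable (B ij)) ->
  P [set w | in_box A (residual_mx sigma F (E w)) /\ in_box B (fitted_of F (E w))] =
  (P [set w | in_box A
        (sigma ^+ 2 *: ((copid_mx r.+1 *m E w)^T *m (copid_mx r.+1 *m E w)))] *
   P [set w | in_box B (fitted_of F (E w))])%E.
Proof.
move=> rF F1 mA mB.
have [Q rQ [resQ PQ]] := residual_rotation n_gt0 rF F1.
pose Z w := Q *m E w.
have iZ : iid_normal P (mx_entries Z) by exact: iid_normal_reflection_prod.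
pose g (M : 'M[R]_(n, p)) : 'M[R]_p := sigma ^+ 2 *: (M^T *m M).
(* For fixed [F] the signal part is a constant matrix; randomness enters through [M] alone. *)
pose h (M : 'M[R]_(n, p)) := col_proj F *m (centering_mx n *m
    ((const_mx 1 : 'cV_n) *m mu^T + F *m G^T)) + sigma *: (col_proj F *m Q^T *m M).
have gE w : residual_mx sigma F (E w) = g (copid_mx r.+1 *m Z w).
  rewrite /residual_mx /g /Z resQ; congr (_ *: _).
  rewrite trmx_mul trmx_mul -!mulmxA; congr (_ *m (_ *m _)).
  by rewrite [RHS]mulmxA copid_mx_gram.
have hE w : fitted_of F (E w) = h (pid_mx r.+1 *m Z w).
  rewrite /fitted_of /h /Z (mulmxDr (centering_mx n)) (mulmxDr (col_proj F)).
  congr (_ + _).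
  by rewrite -!scalemxAr mulmxA col_proj_centering// {1}PQ !mulmxA.
have coordg : random_mx (fun M : mx_space n p => g M).
  apply: random_mxZ; first exact: measurable_cst.
  by apply: random_mxM; first apply: random_mx_tr; exact: random_mx_coord.
have coordh : random_mx (fun M : mx_space n p => h M).
  apply: random_mxD; first exact: random_mx_cst.
  apply: random_mxZ; first exact: measurable_cst.
  by apply: random_mxM; [exact: random_mx_cst|exact: random_mx_coord].
under eq_set do rewrite gE hE.
rewrite iid_normal_split//; congr (_ * _)%E; last first.
  by under [in RHS]eq_set do rewrite hE.
have mD : measurable [set M : mx_space n p | in_box A (g (copid_mx r.+1 *m M))].
  apply: (measurable_box_event (T := mx_space n p) mA).
  apply: random_mxZ; first exact: measurable_cst.
  by apply: random_mxM; first apply: random_mx_tr;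
    apply: random_mxM; (exact: random_mx_cst || exact: random_mx_coord).
exact: (iid_normal_law iZ iE mD).
Qed.

End FixedScores.

Lemma random_mx_col_proj d (T : measurableType d) (R : realType) n r
    (F : T -> 'M[R]_(n, r)) : random_mx F -> random_mx (fun w => col_proj (F w)).
Proof.
move=> mF; have mFT := random_mx_tr mF.
by apply: random_mxM => //; apply: random_mxM => //; apply: random_mx_inv; exact: random_mxM.
Qed.

Section Decomposition.
Context {R : realType}.
Variables (n p r : nat).
Hypothesis n_gt0 : (0 < n)%N.

Lemma rows_mx_sum0 (f : 'I_n -> 'cV[R]_r) : \sum_i f i = 0 ->
  (rows_mx f)^T *m (const_mx 1 : 'cV_n) = 0.
Proof.
move=> f0; apply/matrixP => i j.
transitivity ((\sum_k f k) i 0); last by rewrite f0 !mxE.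
by rewrite mxE summxE; apply: eq_bigr => k _; rewrite !mxE mulr1.
Qed.

(** The matrix [M] = H - P_F is a symmetric idempotent, so X^T X splits as X^T P_F X + (M X)^T (M
    X), and M X = sigma M e since [M] kills the signal. *)
Lemma gram_decomposition (F : 'M[R]_(n, r)) (mu : 'cV[R]_p) (G : 'M[R]_(p, r))
    (sigma : R) (e : 'M[R]_(n, p)) :
  \rank F = r -> F^T *m (const_mx 1 : 'cV_n) = 0 ->
  let X := centering_mx n *m
    ((const_mx 1 : 'cV_n) *m mu^T + F *m G^T + sigma *: e) in
  X^T *m X = (col_proj F *m X)^T *m (col_proj F *m X) + residual_mx sigma F e.
Proof.
move=> rF F1 X; pose M : 'M[R]_n := centering_mx n - col_proj F.
have PH := col_proj_centering F1.
have HT := centering_mx_tr (R := R) n.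
have PT := col_proj_tr F.
have HP : centering_mx n *m col_proj F = col_proj F.
  by apply: trmx_inj; rewrite trmx_mul HT PT.
have PP := col_proj_idem rF.
have PX : (col_proj F)^T *m col_proj F = col_proj F by rewrite PT.
have HH := centering_mx_idem (R := R) n_gt0.
have MT : M^T = M by rewrite /M linearB/= HT PT.
have ME m (Y : 'M[R]_(n, m)) : M *m Y = centering_mx n *m Y - col_proj F *m Y.
  exact: mulmxBl.
have MH : M *m centering_mx n = M by rewrite ME HH PH.
have MM : M *m M = M.
  have -> : M *m M = M *m centering_mx n - M *m col_proj F by exact: mulmxBr.
  by rewrite MH ME HP PP subrr subr0.
have HX : centering_mx n *m X = X by rewrite /X mulmxA HH.
have MX : M *m X = sigma *: (M *m e).
  rewrite /X mulmxA MH !mulmxDr !mulmxA -scalemxAr !ME.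
  by rewrite centering_mx_const// col_proj_const// centering_mx_regular//
    col_proj_id// !subrr !mul0mx !add0r.
(* From here [X] is known only through [HX] and [MX]. *)
clearbody X; rewrite trmx_mul -mulmxA (mulmxA _ (col_proj F)) PX.
transitivity (X^T *m (col_proj F *m X) + (M *m X)^T *m (M *m X)).
  by rewrite (trmx_mul M) MT -(mulmxA X^T M) (mulmxA M M) MM -mulmxDr ME addrC subrK HX.
congr (_ + _); rewrite MX.
have -> : (sigma *: (M *m e))^T = sigma *: (M *m e)^T by exact: linearZ.
rewrite -scalemxAl -scalemxAr scalerA -expr2.
by rewrite (trmx_mul M) MT /residual_mx -/M -(mulmxA e^T M (M *m e)) (mulmxA M M) MM mulmxA.
Qed.

End Decomposition.

Unset Implicit Arguments.
Set Strict Implicit.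
Set Printing Implicit Defensive.

(** That [N] does not involve [Gamma] is expressed by the order of quantifiers: [Nfun] is chosen
    before d, [mu], [Gamma] and [beta]. *)
Theorem lemma5p1 (R : realType) (n p r : nat)
    (n_gt0 : (0 < n)%N) (p_gt0 : (0 < p)%N) (r_gt0 : (0 < r)%N) :
  exists Nfun : ('I_n -> 'cV[R]_r) -> ('I_n -> 'cV[R]_p) -> R -> 'M[R]_p,
  forall (d : nat) (d_gt0 : (0 < d)%N) (ltdp : (d < p)%N) (ledr : (d <= r)%N)
    (mu : 'cV[R]_p) (Gamma : 'M[R]_(p, d)) (beta : 'M[R]_(d, r)) (sigma : R)
    (GammaTGamma : Gamma^T *m Gamma = 1%:M) (sigma_gt0 : 0 < sigma)
    (disp : measure_display) (T : measurableType disp) (P : probability T R)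
    (f : 'I_n -> T -> 'cV[R]_r) (eps : 'I_n -> T -> 'cV[R]_p)
    (f_random : forall i, random_mx (f i))
    (f_regular : {ae P, forall w, regular_scores (f^~ w)})
    (eps_normal : forall i j, standard_normal P (fun w => eps i w j 0))
    (eps_entries_indep : mutual_indep P
       (fun (ij : 'I_n * 'I_p) (w : T) => eps ij.1 w ij.2 0))
    (eps_indep_f : indep_mx P (fun w => rows_mx (eps^~ w))
                              (fun w => rows_mx (f^~ w))),
  let X i w := observation mu Gamma beta sigma (f i w) (eps i w) in
  let XX w := centered_mx (X^~ w) in
  let hatXX w := fitted_mx (f^~ w) (X^~ w) in
  let N w := Nfun (f^~ w) (eps^~ w) sigma in
  [/\ random_mx N,
      forall w, regular_scores (f^~ w) ->
        (XX w)^T *m XX w = (hatXX w)^T *m hatXX w + N w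
    & indep_mx P N hatXX].
Proof.
exists (fun f e sigma => residual_mx sigma (rows_mx f) (rows_mx e)).
move=> d _ _ _ mu Gamma beta sigma _ _ disp T P f eps f_random f_regular eps_normal
  eps_indep eps_indep_f X XX hatXX N.
pose F w := rows_mx (f^~ w); pose E w := rows_mx (eps^~ w).
have XXE w : XX w = centering_mx n *m ((const_mx 1 : 'cV_n) *m mu^T +
    F w *m (Gamma *m beta)^T + sigma *: E w).
  by rewrite /XX centered_mxE rows_observation.
have hatE w : hatXX w = fitted_of sigma mu (Gamma *m beta) (F w) (E w).
  by rewrite /hatXX /fitted_mx -/(XX w) XXE.
have iE : iid_normal P (mx_entries E).
  have entE : mx_entries E = (fun ij w => eps ij.1 w ij.2 0).
    by apply/funext => ij; apply/funext => w; rewrite /mx_entries !mxE.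
  by rewrite entE; split => // ij; exact: eps_normal.
have mF : random_mx F.
  move=> i j; have -> : (fun w => F w i j) = (fun w => f i w j 0).
    by apply/funext => w; rewrite !mxE.
  exact: f_random.
have mE := iid_normal_random_mx iE.
(* The space [S] is arbitrary because this serves both on [T] and on the product of matrix spaces
   used by Fubini. *)
have mres d' (S : measurableType d') (F' : S -> 'M[R]_(n, r)) (E' : S -> 'M[R]_(n, p)) :
    random_mx F' -> random_mx E' -> random_mx (fun w => residual_mx sigma (F' w) (E' w)).
  move=> mF' mE'; apply: random_mxZ; first exact: measurable_cst.
  apply: random_mxM => //; apply: random_mxM; first exact: random_mx_tr.
  apply: random_mxD; first exact: random_mx_cst.
  exact/random_mxN/random_mx_col_proj.
have mfit d' (S : measurableType d') (F' : S -> 'M[R]_(n, r)) (E' : S -> 'M[R]_(n, p)) :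
    random_mx F' -> random_mx E' ->
    random_mx (fun w => fitted_of sigma mu (Gamma *m beta) (F' w) (E' w)).
  move=> mF' mE'; apply: random_mxM; first exact: random_mx_col_proj.
  apply: random_mxM; first exact: random_mx_cst.
  apply: random_mxD; last by apply: random_mxZ => //; exact: measurable_cst.
  apply: random_mxD; first exact: random_mx_cst.
  by apply: random_mxM => //; exact: random_mx_cst.
have mN : random_mx N by exact: mres.
have mhat : random_mx hatXX by rewrite (funext hatE); exact: mfit.
split=> // [w [f0 rF]|].
  rewrite hatE XXE; apply: gram_decomposition => //; exact: rows_mx_sum0.
(* The score-free constant that leaves the integral over [F]. *)
pose kA A := P [set w | in_box A
  (sigma ^+ 2 *: ((copid_mx r.+1 *m E w)^T *m (copid_mx r.+1 *m E w)))].
have mFs := random_mx_measurable mF.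
have mEs := random_mx_measurable mE.
have FE_indep (U : set (mx_space n r)) (V : set (mx_space n p)) :
    measurable U -> measurable V ->
    P (F @^-1` U `&` E @^-1` V) = (P (F @^-1` U) * P (E @^-1` V))%E.
  move=> mU mV; rewrite setIC muleC.
  apply: eps_indep_f.
    exact: (sigma_mx_preimage (M := E)).
  exact: (sigma_mx_preimage (M := F)).
have key A B : (forall ij, measurable (A ij)) -> (forall ij, measurable (B ij)) ->
    P [set w | in_box A (N w) /\ in_box B (hatXX w)] =
    (kA A * P [set w | in_box B (hatXX w)])%E.
  move=> mA mB.
  pose DB : set (mx_space n r * mx_space n p) :=
    [set z | in_box B (fitted_of sigma mu (Gamma *m beta) z.1 z.2)].
  pose D : set (mx_space n r * mx_space n p) :=
    [set z | in_box A (residual_mx sigma z.1 z.2)] `&` DB.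
  have m1 := @random_mx_fst R n r n p; have m2 := @random_mx_snd R n r n p.
  have mDB : measurable DB by exact: (measurable_box_event mB (mfit _ _ _ _ m1 m2)).
  have mD : measurable D.
    by apply: measurableI => //; exact: (measurable_box_event mA (mres _ _ _ _ m1 m2)).
  have hatP : P [set w | in_box B (hatXX w)] =
      (\int[P]_w P [set w' | DB (F w, E w')])%E.
    rewrite -(independent_fubini mFs mEs mDB FE_indep).
    by congr (P _); apply/seteqP; split => w; rewrite /= /DB /= hatE.
  have NhatP : P [set w | in_box A (N w) /\ in_box B (hatXX w)] =
      (\int[P]_w P [set w' | D (F w, E w')])%E.
    rewrite -(independent_fubini mFs mEs mD FE_indep).
    by congr (P _); apply/seteqP; split => w; rewrite /= /D /DB /= hatE.
  have mint := measurable_section_prob P mFs mEs mDB.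
  rewrite NhatP hatP -ge0_integralZl//.
  apply: ge0_ae_eq_integral => //.
  - exact: (measurable_section_prob P mFs mEs mD).
  - exact: measurable_funeM.
  - by move=> w _; rewrite mule_ge0.
  (* The integrands agree at regular scores, that is, outside the null set [Z]. *)
  case: f_regular => Z [mZ PZ regZ]; exists Z; split => // w /= nw; apply: regZ => /=.
  move=> [f0 rF]; apply: nw => _.
  exact: (residual_fitted_indep_fixed sigma mu (Gamma *m beta) n_gt0 iE rF
    (rows_mx_sum0 f0) mA mB).
apply: indep_mx_boxes => // A B mA mB; rewrite key//; congr (_ * _)%E.
(* With no constraint on the fitted matrix, [key] identifies [kA A] as the probability that [N] lies
   in the box [A]. *)
have := key A (fun=> setT) mA (fun=> measurableT).
rewrite (_ : [set w | _ /\ _] = [set w | in_box A (N w)]); last first.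
  by apply/seteqP; split => w //= -[].
rewrite (_ : [set w | in_box (fun=> setT) _] = setT); last exact/seteqP.
by rewrite probability_setT mule1 => ->.
Qed.
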